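(* Let $\kappa$ be a strongly compact cardinal. Then for every cardinal $\lambda\ge\kappa$, the space ${}^{<\kappa}\square\,2^\lambda$ is b-ultraparacompact.
   Context: $2=\{0,1\}$ is discrete. ${}^{<\kappa}\square\,2^\lambda$ is the set of functions $\lambda\to2$ with the topology whose canonical base consists of the clopen sets $[s]=\{f:s\subseteq f\}$ for partial functions $s:\lambda\to2$ with $|\mathrm{dom}(s)|<\kappa$. The space is b-ultraparacompact if every open cover has a refinement (a cover each member of which is contained in a member of the given cover) consisting of pairwise disjoint sets from this canonical base. *)

(* Defs.v *)
From HB Require Import structures.
From mathcomp Require Import all_boot all_order.
From mathcomp Require Import boolp classical_sets functions cardinality filter.
From mathcomp Require Import topology.

Set Implicit Arguments.
Unset Strict Implicit.
Unset Printing Implicit Defensive.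

Local Open Scope classical_set_scope.
Local Open Scope card_scope.

(* Cardinals are represented by types: a type [K] stands for the cardinal of
   its full set [[set: K]]. *)

Definition card_lt T U (A : set T) (B : set U) : Prop :=
  A #<= B /\ ~ (B #<= A).

Definition kappa_complete (K S : Type) (F : set_system S) : Prop :=
  forall D : set (set S), card_lt D [set: K] -> D `<=` F ->
    F (\bigcap_(A in D) A).

(* Regularity of the cardinal is not listed: it follows from the filter
   extension property, as in the usual definition. *)
Definition strongly_compact (K : Type) : Prop :=
  ~ countable [set: K] /\
  forall (S : Type) (F : set_system S),
    ProperFilter F -> kappa_complete K F ->
    exists U : set_system S,
      [/\ UltraFilter U, kappa_complete K U & F `<=` U].

(* [s x = None] means that [x] is not in the domain of the partial function
   [s]. *)
Definition pdom L (s : L -> option bool) : set L := [set x | s x <> None].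

Definition box_cube (K L : Type) : Type := L -> bool.

Definition cylinder (K L : Type) (s : L -> option bool) : set (box_cube K L) :=
  [set f | forall x b, s x = Some b -> f x = b].

Definition box_base (K L : Type) : set (set (box_cube K L)) :=
  [set cylinder s | s in [set s | card_lt (pdom s) [set: K]]].

(* The topology is generated by [box_base] as a subbase, so that it is defined
   without any hypothesis on [K]. When [K] is infinite, the union of two
   domains of cardinality less than [K] is again such a domain, so a nonempty
   finite intersection of members of [box_base] is empty or in [box_base]:
   [box_base] is then a base of this topology. *)
HB.instance Definition _ (K L : Type) :=
  Choice.copy (box_cube K L) (L -> bool).
HB.instance Definition _ (K L : Type) :=
  isSubBaseTopological.Build (box_cube K L) (@box_base K L) id.

Definition b_ultraparacompact (X : topologicalType) (B : set (set X)) : Prop :=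
  forall C : set (set X),
    (forall U, C U -> open U) -> \bigcup_(U in C) U = [set: X] ->
    exists R : set (set X),
      [/\ R `<=` B,
          \bigcup_(V in R) V = [set: X],
          (forall V, R V -> exists2 U, C U & V `<=` U) &
          trivIset R id].

(* Main.v *)
Require Import Defs.
From mathcomp Require Import all_boot all_order.
From mathcomp Require Import boolp classical_sets functions cardinality filter.
From mathcomp Require Import topology.

Set Implicit Arguments.
Unset Strict Implicit.
Unset Printing Implicit Defensive.

Local Open Scope classical_set_scope.
Local Open Scope card_scope.

(** Strong compactness gives a kappa-complete analogue of compactness: for every
open cover of the cube there is a set [A] of fewer than kappa coordinates such
that each [f] has a cover member containing every point agreeing with [f] on
[A].  Otherwise the sets of points that are bad for [A], decreasing in [A],
generate a kappa-complete filter; a kappa-complete ultrafilter extending it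
converges coordinatewise to a point [g], some cover member contains all points
agreeing with [g] on some small [A], and one of these is bad for [A].
Restricting all points to such an [A] yields the partition.

Regularity of kappa comes from the same hypothesis.  If kappa were a union of
fewer than kappa smaller sets, a kappa-complete ultrafilter on the power set of
the finite sequences in kappa, extending the filter of sets whose complement is
no larger than the set of these sequences, would be closed under
intersections of kappa sets, hence under those indexed by finite sequences, and
so would contain a singleton.  Finite sequences replace kappa itself because the
bound kappa * kappa <= kappa is then not needed. *)

(** * Comparison of cardinals *)

Lemma card_le_relP T U (A : set T) (B : set U) :
  A #<= B <-> exists R : T -> U -> Prop,
    (forall x, A x -> exists2 y, B y & R x y) /\
    (forall x x' y, A x -> A x' -> R x y -> R x' y -> x = x').
Proof.
split=> [/card_leP[f]|[R [RAB Rinj]]].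
  exists (fun x y => exists2 a : A, set_val a = x & set_val (f a) = y).
  split=> [x Ax|x x' y _ _ [a <- fa] [b <- fb]].
    pose a : A := SigSub (mem_set Ax).
    by exists (set_val (f a)); [exact: set_valP | exists a].
  congr set_val; apply: (@inj _ _ _ f); rewrite ?inE //.
  by apply: val_inj; rewrite /= -fb in fa *.
have [->|/set0P[x0 Ax0]] := eqVneq A set0; first exact: card_ge0.
have [y0 _ _] := RAB _ Ax0.
(* [R] may be multivalued: one value is chosen on [A], with the default [y0] elsewhere. *)
have /choice[f fP] (x : T) : exists y, A x -> B y /\ R x y.
  by have [/RAB[y By Rxy]|nAx] := pselect (A x); [exists y | exists y0].
have finj : {in A &, injective f}.
  move=> x x'; rewrite !inE => Ax Ax' e; apply: (Rinj _ _ (f x)) => //.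
    by case: (fP _ Ax).
  by rewrite e; case: (fP _ Ax').
have /card_eqPle[_ /card_le_trans] := inj_card_eq finj; apply.
by apply: subset_card_le => _ [x /fP[]] ? _ <-.
Qed.

(** By Zorn there is a maximal graph of a partial injection from [A] to [B]. It is total on [A] or
    onto [B], since otherwise a pair of missed points could be added. *)
Lemma card_le_total T U (A : set T) (B : set U) : A #<= B \/ B #<= A.
Proof.
pose P : set (set (T * U)) := [set G | [/\ G `<=` A `*` B,
  forall x y y', G (x, y) -> G (x, y') -> y = y' &
  forall x x' y, G (x, y) -> G (x', y) -> x = x']].
have [F FP Ftot|G [[GAB Gfun Ginj] Gmax]] := @Zorn_bigcup _ P.
  have dir p q : (\bigcup_(X in F) X) p -> (\bigcup_(X in F) X) q ->
      exists X, [/\ P X, X p & X q].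
    move=> [X FX Xp] [Y FY Yq]; have [XY|YX] := Ftot _ _ FX FY.
      by exists Y; split=> //; [exact: FP | exact: XY].
    by exists X; split=> //; [exact: FP | exact: YX].
  split=> [p [X /FP[XAB _ _] /XAB] //|x y y' Gy Gy'|x x' y Gx Gx'].
    by have [X [[_ Xfun _] /Xfun Xp /Xp]] := dir _ _ Gy Gy'.
  by have [X [[_ _ Xinj] /Xinj Xp /Xp]] := dir _ _ Gx Gx'.
have [domG|] := pselect (forall x, A x -> exists y, G (x, y)).
  left; apply/card_le_relP; exists (fun x y => G (x, y)).
  split=> [x /domG[y Gxy]|x x' y _ _]; last exact: Ginj.
  by exists y => //; case: (GAB _ Gxy).
move=> /existsNP[a /not_implyP[Aa /forallNP Ga]].
right; apply/card_le_relP; exists (fun y x => G (x, y)).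
split=> [b Bb|y y' x _ _]; last exact: Gfun.
apply: contrapT => Gb; apply: (Gmax (G `|` [set (a, b)])).
  split; first exact: subsetUl.
  by move=> /(_ (a, b) (or_intror erefl)) /Ga.
have {}Gb x : ~ G (x, b).
  by move=> Gxb; apply: Gb; exists x => //; case: (GAB _ Gxb).
split=> [_ [/GAB //|->] //|x y y'|x x' y].
- move=> [Gxy|[-> ->]] [Gxy'|[]]; [exact: Gfun Gxy Gxy'| | |by move=> ->].
    by move=> ax; move: Gxy; rewrite ax => /Ga.
  by move/Ga: Gxy'.
- move=> [Gxy|[-> ->]] [Gxy'|[]]; [exact: Ginj Gxy Gxy'| | |by move=> ->].
    by move=> _ yb; move: Gxy; rewrite yb => /Gb.
  by move/Gb: Gxy'.
Qed.

Lemma card_lt_lel T U V (A : set T) (B : set U) (C : set V) :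
  A #<= B -> card_lt B C -> card_lt A C.
Proof.
move=> AB [BC CB]; split; first exact: card_le_trans BC.
by move=> CA; apply: CB; exact: card_le_trans AB.
Qed.

Lemma countable_card_lt K T (A : set T) :
  ~ countable [set: K] -> countable A -> card_lt A [set: K].
Proof.
move=> ncK cA; split; last by move=> /card_le_trans /(_ cA).
apply: (card_le_trans cA); apply/infiniteP.
by move=> /finite_set_countable.
Qed.

(** * Kappa-complete filters *)

Lemma kappa_complete_bigcap K S (F : set_system S) I (D : set I)
    (G : I -> set S) :
  kappa_complete K F -> card_lt D [set: K] -> (forall i, D i -> F (G i)) ->
  F (\bigcap_(i in D) G i).
Proof.
move=> cF Dlt FG; rewrite -(bigcap_image D G id); apply: cF.
  exact: card_lt_lel (card_image_le _ _) Dlt.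
by move=> _ [i Di <-]; exact: FG.
Qed.

Lemma kappa_complete_proper K S (F : set_system S) :
  ~ countable [set: K] -> kappa_complete K F -> ~ F set0 ->
  (forall P Q, P `<=` Q -> F P -> F Q) -> ProperFilter F.
Proof.
move=> ncK cF F0 FS; split=> //; split=> //.
  by rewrite -(bigcap_set0 id); apply: cF => //; exact: countable_card_lt.
move=> P Q FP FQ; have -> : P `&` Q = \bigcap_(X in [set P; Q]) X.
    by rewrite bigcap_setU !bigcap_set1.
  apply: cF.
  by apply: countable_card_lt => //; exact/finite_set_countable/finite_set2.
by move=> _ [->|->].
Qed.

(** * Regularity of kappa *)

Lemma power_card_nle T : ~ ([set: set T] #<= [set: T]).
Proof.
move=> /card_le_relP[R [Rtot Rinj]].
(* Cantor's diagonal set; by [Rinj] it is the only set related to [y]. *)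
have [y _ Ry] := Rtot [set y | exists2 X, R X y & ~ X y] Logic.I.
suff nEy : ~ exists2 X, R X y & ~ X y.
  by apply: (nEy); exists [set y | exists2 X, R X y & ~ X y].
case=> X RXy nXy; apply: (nXy).
by rewrite (Rinj _ _ _ Logic.I Logic.I RXy Ry); exists X.
Qed.

(** A point of [A i] is coded by [k :: l], where [k] codes [i] and [l] codes the point within
    [A i]. *)
Lemma bigcup_seq_card_le K T I (D : set I) (A : I -> set T) :
  D #<= [set: K] -> (forall i, D i -> A i #<= [set: seq K]) ->
  \bigcup_(i in D) A i #<= [set: seq K].
Proof.
move=> /card_le_relP[R [Rtot Rinj]] AK.
have /choice[Q QP] (i : I) : exists Q : T -> seq K -> Prop, D i ->
    (forall x, A i x -> exists2 y, [set: seq K] y & Q x y) /\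
    (forall x x' y, A i x -> A i x' -> Q x y -> Q x' y -> x = x').
  have [/AK/card_le_relP[Q ?]|nDi] := pselect (D i); first by exists Q.
  by exists (fun _ _ => True).
apply/card_le_relP.
exists (fun x s => exists i k l,
  [/\ s = k :: l, D i, A i x, R i k & Q i x l]).
split=> [x [i Di Aix]|x x' _ _ _ [i [k [l [-> Di Aix Rik Qil]]]]].
  have [k _ Rik] := Rtot _ Di; have [l _ Qil] := (QP _ Di).1 _ Aix.
  by exists (k :: l) => //; exists i, k, l.
move=> [j [k' [l' [[<- <-] Dj Ajx' Rjk Qjl]]]].
have eij := Rinj _ _ _ Di Dj Rik Rjk; rewrite -eij in Ajx' Qjl.
exact: (QP _ Di).2 Qil Qjl.
Qed.

(** Induction on the length, splitting off the head, treats the sequences of each fixed length; the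
    lengths are countably many, hence fewer than kappa. *)
Lemma kappa_complete_bigcap_seq K S (F : set_system S) :
  ~ countable [set: K] -> kappa_complete K F -> F setT ->
  (forall G : K -> set S, (forall k, F (G k)) -> F (\bigcap_k G k)) ->
  forall G : seq K -> set S, (forall l, F (G l)) -> F (\bigcap_l G l).
Proof.
move=> ncK cF FT FK G FG.
have Fn n : forall H : seq K -> set S, (forall l, F (H l)) ->
    F (\bigcap_(l in [set l | size l = n]) H l).
  elim: n => [|n IHn] H FH.
    suff -> : [set l : seq K | size l = 0] = [set [::]] by rewrite bigcap_set1.
    by apply/seteqP; split=> [l /size0nil|l ->].
  suff -> : \bigcap_(l in [set l | size l = n.+1]) H l =
      \bigcap_k \bigcap_(l in [set l | size l = n]) H (k :: l).
    by apply: FK => k; exact: IHn.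
  apply/seteqP; split=> [x Hx k _ l ln|x Hx [//|k l] [ln]].
    by apply: Hx; rewrite /= ln.
  exact: Hx.
suff -> : \bigcap_l G l = \bigcap_n \bigcap_(l in [set l | size l = n]) G l.
  apply: (kappa_complete_bigcap cF) => [|n _]; last exact: Fn.
  by apply: countable_card_lt => //; exact: card_lexx.
apply/seteqP; split=> [x Gx n _ l _|x Gx l _]; first exact: Gx.
exact: Gx (size l) _ _ _.
Qed.

Lemma strongly_compact_no_small_cover K I (D : set I) (B : I -> set K) :
  strongly_compact K -> card_lt D [set: K] ->
  (forall i, D i -> card_lt (B i) [set: K]) ->
  \bigcup_(i in D) B i <> [set: K].
Proof.
move=> [ncK scK] Dlt Blt DB.
pose F : set_system (set (seq K)) := [set X | ~` X #<= [set: seq K]].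
have cF : kappa_complete K F.
  move=> E [EK _] EF; rewrite /F /= setC_bigcap.
  by apply: bigcup_seq_card_le => // X /EF.
have pF : ProperFilter F.
  apply: (kappa_complete_proper ncK cF) => [|P Q PQ].
    by rewrite /F /= setC0; exact: power_card_nle.
  by apply: card_le_trans; apply: subset_card_le; exact: subsetC.
have [U [uU cU FU]] := scK _ _ pF cF.
have UK (G : K -> set (set (seq K))) : (forall k, U (G k)) -> U (\bigcap_k G k).
  (* As the [B i] cover [K], the intersection over [K] splits into fewer than kappa intersections of
     fewer than kappa sets each. *)
  move=> UG; suff -> : \bigcap_k G k = \bigcap_(i in D) \bigcap_(k in B i) G k.
    apply: (kappa_complete_bigcap cU Dlt) => i Di.
    by apply: (kappa_complete_bigcap cU (Blt _ Di)) => k _.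
  apply/seteqP; split=> [x Gx i _ k _|x Gx k _]; first exact: Gx.
  have : (\bigcup_(i in D) B i) k by rewrite DB.
  by case=> i Di Bik; exact: Gx Di _ Bik.
(* [U] decides each question [X l], and [g] collects the positive answers; so the [G l] below
   intersect in the singleton of [g]. *)
pose g : set (seq K) := [set l | U [set X | X l]].
pose G l : set (set (seq K)) := [set X | X l <-> g l].
have UG l : U (G l).
  have [gl|ngl] := pselect (g l); first by apply: filterS (gl) => X Xl.
  have [//|] := in_ultra_setVsetC [set X : set (seq K) | X l] uU.
  by apply: filterS => X Xl; split=> [/Xl|/ngl].
have Ug : U (\bigcap_l G l).
  by apply: kappa_complete_bigcap_seq UK _ UG => //; exact: filterT.
have Ung : U (~` [set g]).
  apply: FU; rewrite /F /= setCK; apply/card_le_relP.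
  exists (fun _ _ => True); split=> [x _|x x' _ -> -> //].
  by exists [::].
apply: (filter_not_empty U); apply: filterS (filterI Ug Ung) => X [GX]; apply.
by apply/seteqP; split=> l; have [] := GX l Logic.I.
Qed.

(** An injection of [K] into the union would pull the [A i] back to a cover of [K] by fewer than
    kappa smaller sets; comparability of cardinals then gives the bound. *)
Lemma strongly_compact_bigcup K I T (D : set I) (A : I -> set T) :
  strongly_compact K -> card_lt D [set: K] ->
  (forall i, D i -> card_lt (A i) [set: K]) ->
  card_lt (\bigcup_(i in D) A i) [set: K].
Proof.
move=> scK Dlt Alt.
suff nle : ~ ([set: K] #<= \bigcup_(i in D) A i).
  by split=> //; have [] := card_le_total (\bigcup_(i in D) A i) [set: K].
move=> /card_le_relP[R [Rtot Rinj]].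
apply: (@strongly_compact_no_small_cover _ _ D
  (fun i => [set k | exists2 y, A i y & R k y]) scK Dlt).
  move=> i Di; apply: card_lt_lel (Alt _ Di); apply/card_le_relP.
  by exists R; split=> // k k' y _ _; exact: Rinj.
apply/seteqP; split=> // k _; have [y [i Di Aiy] Rky] := Rtot k Logic.I.
by exists i => //; exists y.
Qed.

(** * Small sets of coordinates for open sets and covers *)

Lemma open_box_cube K L (V : set (box_cube K L)) f :
  strongly_compact K -> open V -> V f ->
  exists2 A : set L, card_lt A [set: K] &
    forall h : box_cube K L, (forall x, A x -> h x = f x) -> V h.
Proof.
move=> scK [D' sD' <-] [W D'W Wf]; have [E sE defW] := sD' _ D'W.
move: defW Wf; set Es := (X in \bigcap_(i in X) _) => defW Wf.
have Ef i : Es i -> i f.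
  by move: i; change ((\bigcap_(i in Es) i) f); rewrite -defW in Wf.
have {}sE i : Es i -> @box_base K L i by move/sE/set_mem.
have finE : finite_set Es by exact: finite_fset.
have /choice[s sP] (i : set (box_cube K L)) : exists s : L -> option bool,
    Es i -> card_lt (pdom s) [set: K] /\ cylinder s = i.
  have [/sE[s]|] := pselect (Es i); first by exists s.
  by exists (fun _ => None).
(* Near [f], [V] contains a finite intersection of cylinders, so agreement on all their domains
   suffices. *)
exists (\bigcup_(i in Es) pdom (s i)).
  apply: strongly_compact_bigcup => // [|i /sP[] //].
  by apply: countable_card_lt; [case: scK | exact: finite_set_countable].
move=> h hf; exists W => //; rewrite -defW /= => i Ei; change (i h).
have := Ef i Ei; rewrite -(sP _ Ei).2 => fs x b sx.
by rewrite hf ?(fs _ _ sx) //; exists i; rewrite // /pdom /= sx.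
Qed.

Lemma strongly_compact_cover K L (C : set (set (box_cube K L))) :
  strongly_compact K -> (forall U, C U -> open U) ->
  \bigcup_(U in C) U = [set: box_cube K L] ->
  exists2 A : set L, card_lt A [set: K] &
    forall f : box_cube K L, exists2 U, C U &
      forall h : box_cube K L, (forall x, A x -> h x = f x) -> U h.
Proof.
move=> scK Copen Ccov; apply: contrapT => nA.
pose bad (A : set L) : set (box_cube K L) := [set f | ~ exists2 U, C U &
  forall h : box_cube K L, (forall x, A x -> h x = f x) -> U h].
have bad_sub A A' : A `<=` A' -> bad A' `<=` bad A.
  move=> AA' f bf [U CU fU]; apply: bf; exists U => // h hf.
  by apply: fU => x /AA'; exact: hf.
pose F : set_system (box_cube K L) :=
  [set X | exists2 A : set L, card_lt A [set: K] & bad A `<=` X].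
have ncK := scK.1.
have cF : kappa_complete K F.
  move=> D Dlt DF.
  have /choice[A AP] X : exists A : set L,
      D X -> card_lt A [set: K] /\ bad A `<=` X.
    by have [/DF[A]|] := pselect (D X); [exists A | exists set0].
  (* As [bad] is antitone, this union serves all [X] in [D] at once; it is small by regularity. *)
  exists (\bigcup_(X in D) A X).
    by apply: strongly_compact_bigcup => // X /AP[].
  move=> f bf X DX; apply: (AP _ DX).2; apply: bad_sub bf.
  exact: bigcup_sup.
have pF : ProperFilter F.
  apply: (kappa_complete_proper ncK cF) => [[A Alt bA]|P Q PQ [A Alt bA]].
    by apply: nA; exists A => // f; apply: contrapT => /bA.
  by exists A => //; exact: subset_trans PQ.
have [W [uW cW FW]] := scK.2 _ _ pF cF.
(* [g x] is the value at [x] shared by [W]-almost all points. *)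
pose g : box_cube K L := fun x => `[< W [set f | f x = true] >].
have Wg x : W [set f : box_cube K L | f x = g x].
  rewrite /g; case: asboolP => //.
  have [//|] := in_ultra_setVsetC [set f : box_cube K L | f x = true] uW.
  by move=> + _; apply: filterS => f /= /negP/negbTE.
have : (\bigcup_(U in C) U) g by rewrite Ccov.
move=> [V CV Vg]; have [A Alt AV] := open_box_cube scK (Copen _ CV) Vg.
have WA := kappa_complete_bigcap cW Alt (fun x _ => Wg x).
have Wbad : W (bad A) by apply: FW; exists A.
(* If [f] agrees with [g] on [A], so do all points agreeing with [f] on [A]; they lie in [V], and
   [f] is not bad. *)
apply: (filter_not_empty W); apply: filterS (filterI WA Wbad) => f [fg]; apply.
by exists V => // h hf; apply: AV => x Ax; rewrite hf //; exact: fg.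
Qed.

Theorem theorem7p6 (K : Type) :
  strongly_compact K ->
  forall L : Type, [set: K] #<= [set: L] ->
    b_ultraparacompact (@box_base K L).
Proof.
move=> scK L _ C Copen Ccov.
have [A Alt AC] := strongly_compact_cover scK Copen Ccov.
pose res (f : box_cube K L) x := if x \in A then Some (f x) else None.
have resP f : cylinder (res f) =
    [set h : box_cube K L | forall x, A x -> h x = f x].
  apply/seteqP; split=> h hf x.
    by move=> /mem_set xA; apply: hf; rewrite /res xA.
  by rewrite /res => b; case: ifP => // /set_mem /hf -> [].
exists [set cylinder (res f) | f in [set: box_cube K L]]; split.
- move=> _ [f _ <-]; exists (res f) => //; apply: card_lt_lel Alt.
  apply: subset_card_le => x.
  by rewrite /pdom /res /=; case: ifP => // /set_mem.
- apply/seteqP; split=> // f _; exists (cylinder (res f)); first by exists f.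
  by rewrite resP.
- move=> _ [f _ <-]; have [U CU fU] := AC f; exists U => //.
  by rewrite resP.
(* A common point [h] forces [f] and [f'] to agree on [A], so the two cylinders coincide. *)
- move=> _ _ [f _ <-] [f' _ <-] [h []]; rewrite !resP /= => hf hf'.
  by apply/seteqP; split=> h' /= hh x Ax; rewrite hh // -?hf -?hf'.
Qed.
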